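(* Let $L\in\mathcal{L}$ and let $\mathcal{M}$ be a non-negative, symmetric and homogeneous mean function. Then the dual mean reversiblization $D_{\mathcal{M}}$ is $\pi$-reversible, that is, $D_{\mathcal{M}}\in\mathcal{L}(\pi)$, where $D_{\mathcal{M}}:=F_g$ with balancing function $$g(t)=\begin{cases}t\,\mathcal{M}^*(1/t,1)=\dfrac{1}{\mathcal{M}(1/t,1)},&t>0,\\ 0,&t=0.\end{cases}$$
   Context: $\mathcal{X}$ is a finite set and $\pi$ is a fixed probability distribution on $\mathcal{X}$ with $\pi(x)>0$ for all $x$. $\mathcal{L}$ is the set of Markov infinitesimal generators on $\mathcal{X}$, i.e. $\mathcal{X}\times\mathcal{X}$ real matrices with non-negative off-diagonal entries and all row sums zero. $\mathcal{L}(\pi)\subseteq\mathcal{L}$ is the set of $\pi$-reversible generators, i.e. those $M$ with $\pi(x)M(x,y)=\pi(y)M(y,x)$ for all $x,y$. The $\pi$-dual $L_\pi$ of $L\in\mathcal{L}$ is the generator with off-diagonal entries $L_\pi(x,y)=\frac{\pi(y)}{\pi(x)}L(y,x)$, $x\neq y$, and diagonal entries such that all row sums are zero. A function $\mathcal{M}:\mathbb{R}_+\times\mathbb{R}_+\to\mathbb{R}_+$ is a mean function if $\min\{a,b\}\le\mathcal{M}(a,b)\le\max\{a,b\}$ for all $a,b\in\mathbb{R}_+$. It is symmetric if $\mathcal{M}(a,b)=\mathcal{M}(b,a)$, and homogeneous if $\mathcal{M}(\lambda a,\lambda b)=\lambda\mathcal{M}(a,b)$ for any $\lambda\ge0$.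 Its dual mean is $\mathcal{M}^*(a,b)=\frac{ab}{\mathcal{M}(a,b)}$ if $a>0$ or $b>0$, and $0$ otherwise. A balancing function is $g:\mathbb{R}_+\to\mathbb{R}_+$ with $g(t)=tg(1/t)$ for $t>0$. Given $L\in\mathcal{L}$ and such $g$, $F_g$ is defined for $x\ne y$ by $$F_g(x,y):=\begin{cases}L(x,y),&L(x,y)=L_\pi(x,y),\\ g(0)L_\pi(x,y),&L(x,y)=0\text{ and }L_\pi(x,y)>0,\\ g\!\left(\frac{L_\pi(x,y)}{L(x,y)}\right)L(x,y),&\text{otherwise},\end{cases}$$ with diagonal entries such that all row sums are zero. *)

(* Defs.v *)
From mathcomp Require Import all_boot all_order all_algebra.
From mathcomp Require Import reals.

Set Implicit Arguments.
Unset Strict Implicit.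
Unset Printing Implicit Defensive.

Import Order.TTheory GRing.Theory Num.Theory.
Local Open Scope ring_scope.

Section Generators.
Variables (R : realType) (X : finType).

Definition positive_distribution (pi : X -> R) : Prop :=
  (forall x, 0 < pi x) /\ \sum_x pi x = 1.

Definition generator (L : X -> X -> R) : Prop :=
  (forall x y, x != y -> 0 <= L x y) /\ (forall x, \sum_y L x y = 0).

Definition reversible_generator (pi : X -> R) (L : X -> X -> R) : Prop :=
  generator L /\ (forall x y, pi x * L x y = pi y * L y x).

(* The matrix with the off-diagonal entries of A and all row sums zero; the
   diagonal entries of A are ignored. *)
Definition fill_diagonal (A : X -> X -> R) (x y : X) : R :=
  if x == y then - \sum_(z | z != x) A x z else A x y.

Definition pi_dual (pi : X -> R) (L : X -> X -> R) : X -> X -> R :=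
  fill_diagonal (fun x y => pi y / pi x * L y x).

Definition F_balanced (pi : X -> R) (g : R -> R) (L : X -> X -> R) :
    X -> X -> R :=
  let Lpi := pi_dual pi L in
  fill_diagonal (fun x y =>
    if L x y == Lpi x y then L x y
    else if (L x y == 0) && (0 < Lpi x y) then g 0 * Lpi x y
    else g (Lpi x y / L x y) * L x y).

End Generators.

(* Functions on R_+ are represented by functions on R, of which only the values
   at non-negative arguments are constrained or used. *)
Section Means.
Variable R : realType.

Definition mean_function (M : R -> R -> R) : Prop :=
  forall a b, 0 <= a -> 0 <= b ->
    [/\ 0 <= M a b, Num.min a b <= M a b & M a b <= Num.max a b].

Definition symmetric_mean (M : R -> R -> R) : Prop :=
  forall a b, 0 <= a -> 0 <= b -> M a b = M b a.

Definition homogeneous_mean (M : R -> R -> R) : Prop :=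
  forall l a b, 0 <= l -> 0 <= a -> 0 <= b -> M (l * a) (l * b) = l * M a b.

(* If exactly one argument is positive, M a b may vanish; the quotient 0 / 0 is
   then 0. *)
Definition dual_mean (M : R -> R -> R) (a b : R) : R :=
  if (0 < a) || (0 < b) then a * b / M a b else 0.

Definition balancing_function (g : R -> R) : Prop :=
  (forall t, 0 <= t -> 0 <= g t) /\ (forall t, 0 < t -> g t = t * g t^-1).

Definition dual_mean_balancing (M : R -> R -> R) (t : R) : R :=
  if 0 < t then t * dual_mean M t^-1 1 else 0.

End Means.

Definition dual_mean_reversiblization (R : realType) (X : finType)
    (pi : X -> R) (M : R -> R -> R) (L : X -> X -> R) : X -> X -> R :=
  F_balanced pi (dual_mean_balancing M) L.

(* Main.v *)
Require Import Defs.
From mathcomp Require Import all_boot all_order all_algebra.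
From mathcomp Require Import reals.

(** The dual mean M^*(a, b) = ab / M(a, b) inherits symmetry and homogeneity
    from M, and it fixes the diagonal. Homogeneity turns the balancing function
    into g(t) = M^*(1, t) and then collapses the three cases of F_g into one
    formula (lemma [balancing_rateE]): off the diagonal,
    F_g(x, y) = M^*(L(x, y), L_pi(x, y)).  Moving pi(x) inside M^* gives
      pi(x) F_g(x, y) = M^*(pi(x) L(x, y), pi(y) L(y, x)),
    whose right-hand side is symmetric in x and y because M^* is. This is
    detailed balance; the rates are non-negative since M is, and the diagonal
    is chosen so that rows sum to zero. *)

Import Order.TTheory GRing.Theory Num.Theory.
Local Open Scope ring_scope.

Section FillDiagonal.
Variables (R : realType) (X : finType).
Implicit Types (pi : X -> R) (A : X -> X -> R).

Lemma fill_diagonal_off A x y : x != y -> fill_diagonal A x y = A x y.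
Proof. by rewrite /fill_diagonal => /negbTE ->. Qed.

Lemma fill_diagonal_generator A :
  (forall x y, x != y -> 0 <= A x y) -> generator (fill_diagonal A).
Proof.
move=> A_ge0; split=> [x y xy|x]; first by rewrite fill_diagonal_off ?A_ge0.
rewrite (bigD1 x) //= {1}/fill_diagonal eqxx.
rewrite (eq_bigr (A x)) ?addNr // => y yx.
by rewrite fill_diagonal_off // eq_sym.
Qed.

Lemma fill_diagonal_reversible pi A :
  (forall x y, x != y -> 0 <= A x y) ->
  (forall x y, x != y -> pi x * A x y = pi y * A y x) ->
  reversible_generator pi (fill_diagonal A).
Proof.
move=> A_ge0 balA; split; first exact: fill_diagonal_generator.
move=> x y; have [-> //|xy] := eqVneq x y.
have yx : y != x by rewrite eq_sym.
by rewrite !fill_diagonal_off // balA.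
Qed.

End FillDiagonal.

Section DualMean.
Variables (R : realType) (M : R -> R -> R).
Hypotheses (Hmean : mean_function M) (Hsym : symmetric_mean M).
Hypothesis (Hhom : homogeneous_mean M).

(** The case split in the dual mean disappears on non-negative arguments: at
    (0, 0) the numerator already vanishes. *)
Lemma dual_meanE a b : 0 <= a -> 0 <= b -> dual_mean M a b = a * b / M a b.
Proof.
rewrite /dual_mean !le_eqVlt.
case/predU1P => [<-|->] //; case/predU1P => [<-|->]; rewrite ?orbT //.
by rewrite ltxx mul0r mul0r.
Qed.

Lemma dual_mean_ge0 a b : 0 <= a -> 0 <= b -> 0 <= dual_mean M a b.
Proof.
move=> a0 b0; rewrite dual_meanE // divr_ge0 ?mulr_ge0 //.
by case: (Hmean a b a0 b0).
Qed.

Lemma dual_mean_sym a b :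
  0 <= a -> 0 <= b -> dual_mean M a b = dual_mean M b a.
Proof. by move=> a0 b0; rewrite !dual_meanE // Hsym // (mulrC a). Qed.

Lemma dual_mean_hom l a b : 0 <= l -> 0 <= a -> 0 <= b ->
  dual_mean M (l * a) (l * b) = l * dual_mean M a b.
Proof.
move=> l0 a0 b0; rewrite !dual_meanE ?mulr_ge0 // Hhom //.
have [->|l_neq0] := eqVneq l 0; first by rewrite !mul0r.
by rewrite (mulrCA _ l) -mulf_div divff // mul1r !mulrA.
Qed.

Lemma dual_mean_diag a : 0 <= a -> dual_mean M a a = a.
Proof.
move=> a0; rewrite dual_meanE //.
have -> : M a a = a.
  have [_] := Hmean a a a0 a0; rewrite minxx maxxx => le_aM le_Ma.
  by apply/le_anti; rewrite le_aM le_Ma.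
have [->|a_neq0] := eqVneq a 0; first by rewrite mul0r mul0r.
by rewrite mulfK.
Qed.

Lemma dual_mean_balancingV t :
  0 < t -> dual_mean_balancing M t = (M t^-1 1)^-1.
Proof.
move=> t0; rewrite /dual_mean_balancing t0 dual_meanE ?invr_ge0 ?ltW //.
by rewrite mulr1 mulVKf // gt_eqF.
Qed.

(** In this form the balancing identity g(t) = t g(1/t) is just symmetry and
    homogeneity of M^*, and t = 0 is no longer a special case. *)
Lemma dual_mean_balancingE t :
  0 <= t -> dual_mean_balancing M t = dual_mean M 1 t.
Proof.
rewrite /dual_mean_balancing le_eqVlt => /predU1P[<-|t0].
  by rewrite ltxx dual_meanE // mulr0 mul0r.
by rewrite t0 -dual_mean_hom ?invr_ge0 ?ltW // mulr1 mulfV // gt_eqF.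
Qed.

Lemma dual_mean_balancing_function :
  balancing_function (dual_mean_balancing M).
Proof.
split=> t t0; first by rewrite dual_mean_balancingE ?dual_mean_ge0.
rewrite !dual_mean_balancingE ?invr_ge0 ?ltW //.
rewrite -dual_mean_hom ?invr_ge0 ?ltW //.
by rewrite mulr1 mulfV ?gt_eqF // dual_mean_sym // ltW.
Qed.

(** The three cases in the definition of F_g agree with M^*(a, b): equal rates
    are fixed by the mean property, both sides vanish when a = 0 < b, and
    otherwise a M^*(1, b/a) = M^*(a, b) by homogeneity. *)
Lemma balancing_rateE a b : 0 <= a -> 0 <= b ->
  (if a == b then a
   else if (a == 0) && (0 < b) then dual_mean_balancing M 0 * b
   else dual_mean_balancing M (b / a) * a) = dual_mean M a b.
Proof.
move=> a0 b0; have [<-|ab] := eqVneq a b; first by rewrite dual_mean_diag.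
have [az|a_neq0] /= := eqVneq a 0.
  rewrite az in ab *.
  rewrite lt_def eq_sym ab b0 /= /dual_mean_balancing ltxx.
  by rewrite dual_meanE // !mul0r.
rewrite dual_mean_balancingE ?divr_ge0 // mulrC -dual_mean_hom ?divr_ge0 //.
by rewrite mulr1 mulrC divfK.
Qed.

Lemma dual_mean_reversiblization_reversible (X : finType) (pi : X -> R)
    (L : X -> X -> R) :
  (forall x, 0 < pi x) -> generator L ->
  reversible_generator pi (dual_mean_reversiblization pi M L).
Proof.
move=> pi_gt0 [L_ge0 _]; rewrite /dual_mean_reversiblization /F_balanced.
have pi_ge0 x : 0 <= pi x by rewrite ltW.
have Lpi_ge0 x y : x != y -> 0 <= pi_dual pi L x y.
  move=> xy; rewrite /pi_dual fill_diagonal_off //.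
  by rewrite mulr_ge0 ?divr_ge0 // L_ge0 // eq_sym.
(* The factor pi(x) cancels the denominator of L_pi(x, y). *)
have flux x y : x != y ->
    pi x * dual_mean M (L x y) (pi_dual pi L x y)
    = dual_mean M (pi x * L x y) (pi y * L y x).
  move=> xy; rewrite -dual_mean_hom ?L_ge0 ?Lpi_ge0 //.
  rewrite /pi_dual fill_diagonal_off //.
  by rewrite (mulrA (pi x)) (mulrC (pi x) (_ / _)) divfK ?gt_eqF.
apply: fill_diagonal_reversible => x y xy; have yx := xy; rewrite eq_sym in yx.
  by rewrite balancing_rateE ?dual_mean_ge0 ?L_ge0 ?Lpi_ge0.
rewrite !balancing_rateE ?L_ge0 ?Lpi_ge0 // !flux //.
by rewrite dual_mean_sym ?mulr_ge0 ?L_ge0.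
Qed.

End DualMean.

Theorem theorem4p4 (R : realType) (X : finType) (pi : X -> R)
    (Hpi : positive_distribution pi)
    (L : X -> X -> R) (HL : generator L)
    (M : R -> R -> R) (Hmean : mean_function M)
    (Hsym : symmetric_mean M) (Hhom : homogeneous_mean M) :
  [/\ forall t : R, 0 < t -> dual_mean_balancing M t = (M t^-1 1)^-1,
      balancing_function (dual_mean_balancing M) &
      reversible_generator pi (dual_mean_reversiblization pi M L)].
Proof.
split.
- by move=> t; apply: dual_mean_balancingV.
- exact: dual_mean_balancing_function.
- by case: Hpi => pi_gt0 _; apply: dual_mean_reversiblization_reversible.
Qed.
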